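(* Let $n\ge 1$ and $N\ge 2$ be integers, let $p:Z[1-n,N]\to\mathbb{R}$ satisfy $p(k)\ge 0$ for all $k$, and let $f:Z[1,N]\times\mathbb{R}\to\mathbb{R}$ be continuous. Assume that at least one of the following conditions holds: (i) there exist constants $M\ge 0$ and $\alpha>\frac12 4^n\max p$ such that $F(k,u)\ge\alpha u^2$ for all $k\in Z[1,N]$ and all $|u|>M$; (ii) there exist constants $M\ge 0$, $\alpha>0$, $q>2$ such that $F(k,u)\ge\alpha|u|^q$ for all $k\in Z[1,N]$ and all $|u|>M$. Then the functional $J$ is anti-coercive on $E$, i.e. $J(x)\to-\infty$ as $\|x\|\to\infty$, and the boundary value problem $$\Delta^n\big(p(k-n)\Delta^n x(k-n)\big)+(-1)^{n+1}f(k,x(k))=0\ \text{ for } k\in Z[1,N],\qquad x(i)=0\ \text{ for } i\in Z[1-n,0]\cup Z[N+1,N+n]$$ has at least one solution.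
   Context: For integers $a\le b$, $Z[a,b]=\{a,a+1,\dots,b\}$. $\Delta$ is the forward difference operator, $\Delta x(i)=x(i+1)-x(i)$, and $\Delta^n$ is its $n$-th iterate. $E$ is the space of functions $x:Z[1-n,N+n]\to\mathbb{R}$ with $x(i)=0$ for $i\in Z[1-n,0]\cup Z[N+1,N+n]$, with norm $\|x\|=\left(\sum_{k=1}^N x(k)^2\right)^{1/2}$. $F(k,s)=\int_0^s f(k,t)\,dt$ for $k\in Z[1,N]$. The functional $J:E\to\mathbb{R}$ is $J(x)=\sum_{k=1-n}^{N}\left[\frac12 p(k)(\Delta^n x(k))^2-F(k,x(k))\right]$, where for $k\in Z[1-n,0]$ (where $x(k)=0$) the term $F(k,x(k))=F(k,0)$ is taken to be $0$. $\max p$ denotes the maximum of $p(k)$ over $k\in Z[1-n,N]$. A solution is an element $x\in E$ satisfying the difference equation for every $k\in Z[1,N]$. *)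

(* Defs.v *)
From mathcomp Require Import all_boot all_order all_algebra.
From mathcomp Require Import all_classical all_reals all_analysis.

Set Implicit Arguments.
Unset Strict Implicit.
Unset Printing Implicit Defensive.

Import Order.TTheory GRing.Theory Num.Theory.
Import numFieldNormedType.Exports.

Local Open Scope classical_set_scope.
Local Open Scope ring_scope.

(* A function on an interval of integers is represented by a total function on
   int; every definition below reads it on the relevant interval only. *)

(* Z[a, b], in increasing order and without repetition; empty if b < a. *)
Definition Zint (a b : int) : seq int :=
  if a <= b then [seq a + i%:Z | i <- iota 0 `|b - a|.+1] else [::].

Lemma mem_Zint (a b k : int) : (k \in Zint a b) = (a <= k <= b).
Proof.
rewrite /Zint; case: ifPn => [ab|]; last first.
  rewrite -ltNge => ba; rewrite in_nil; apply/esym/negP => /andP[ak kb].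
  by have := le_lt_trans (le_trans ak kb) ba; rewrite ltxx.
have eab : b - a = `|b - a|%N%:Z by rewrite gez0_abs// subr_ge0.
apply/mapP/andP => [[i]|[ak kb]].
  rewrite mem_iota add0n ltnS /= => ib ->; split; first by rewrite lerDl.
  by rewrite addrC -lerBrDr eab lez_nat.
have ek : k - a = `|k - a|%N%:Z by rewrite gez0_abs// subr_ge0.
exists `|k - a|%N; last by rewrite -ek addrC subrK.
by rewrite mem_iota add0n ltnS /= -lez_nat -eab -ek lerD2r.
Qed.

Lemma uniq_Zint (a b : int) : uniq (Zint a b).
Proof.
rewrite /Zint; case: ifP => // _.
by rewrite map_inj_uniq ?iota_uniq// => i j /addrI[].
Qed.

Section Problem.
Context {R : realType}.
Implicit Types (x p : int -> R) (f : int -> R -> R).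

Definition fdiff x : int -> R := fun i => x (i + 1) - x i.

Definition fdiffn (n : nat) x : int -> R := iter n fdiff x.

Definition spaceE (n N : nat) : set (int -> R) :=
  [set x | forall i : int,
     i \in Zint (1 - n%:Z) 0 \/ i \in Zint (N%:Z + 1) (N%:Z + n%:Z) ->
     x i = 0].

Definition normE (N : nat) x : R :=
  Num.sqrt (\sum_(k <- Zint 1 N%:Z) x k ^+ 2).

(* Joint continuity on Z[1, N] * R, the first factor being discrete. *)
Definition jointly_continuous (N : nat) f : Prop :=
  {within [set kt : discrete_topology int * R | kt.1 \in Zint 1 N%:Z],
    continuous (fun kt : discrete_topology int * R => f kt.1 kt.2)}.

(* The oriented integral of f k from 0 to s. *)
Definition primF f (k : int) (s : R) : R :=
  if 0 <= s then \int[lebesgue_measure]_(t in `[0, s]) f k t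
  else - \int[lebesgue_measure]_(t in `[s, 0]) f k t.

(* x vanishes on Z[1-n, 0], where the second term is taken to be 0. *)
Definition functionalJ (n N : nat) p f x : R :=
  \sum_(k <- Zint (1 - n%:Z) N%:Z)
    (2^-1 * p k * fdiffn n x k ^+ 2
     - (if 1 <= k then primF f k (x k) else 0)).

(* The default p (1 - n) is itself one of the values, so this is the maximum. *)
Definition maxp (n N : nat) p : R :=
  \big[Num.max/p (1 - n%:Z)]_(k <- Zint (1 - n%:Z) N%:Z) p k.

Definition anti_coercive (n N : nat) (J : (int -> R) -> R) : Prop :=
  forall A : R, exists B : R,
    forall x, spaceE n N x -> B < normE N x -> J x < A.

Definition is_solution (n N : nat) p f x : Prop :=
  spaceE n N x /\
  forall k : int, k \in Zint 1 N%:Z ->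
    fdiffn n (fun j => p (j - n%:Z) * fdiffn n x (j - n%:Z)) k
    + (-1) ^+ n.+1 * f k (x k) = 0.

End Problem.

(* Main.v *)
(* On E the quadratic part of J is at most (4^n max p / 2) |x|^2, since each
   forward difference at most quadruples the sum of squares; either growth
   condition makes the sum of the F(k, x(k)) exceed this by a positive multiple
   of |x|^2, so J is anti-coercive.  Hence J, continuous on a finite-dimensional
   space, attains its maximum, and vanishing of its partial derivatives there is,
   after summation by parts, the difference equation. *)

Require Import Defs.
From mathcomp Require Import all_boot all_order all_algebra.
From mathcomp Require Import all_classical all_reals all_analysis.
From mathcomp Require Import zify ring lra.

Set Implicit Arguments.
Unset Strict Implicit.
Unset Printing Implicit Defensive.

Import Order.TTheory GRing.Theory Num.Theory.
Import numFieldNormedType.Exports.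

Local Open Scope classical_set_scope.
Local Open Scope ring_scope.

(** * Iterated forward differences: norm bound and summation by parts *)

Section FiniteDifferences.
Context {R : realType}.
Implicit Types (x y g : int -> R) (a k : int).

Lemma sum_Zint a (m : nat) g :
  \sum_(k <- Zint a (a + m%:Z - 1)) g k = \sum_(0 <= i < m) g (a + i%:Z).
Proof.
rewrite /Zint; case: m => [|m]; first by rewrite big_geq// ifN ?big_nil//; lia.
rewrite (_ : a + m.+1%:Z - 1 = a + m%:Z); last by lia.
rewrite lerDl lez_nat leq0n addrAC subrr add0r absz_nat big_map.
by rewrite /index_iota subn0.
Qed.

Lemma sum_Zint_support a b c d g : a <= c -> d <= b ->
  (forall k, k \in Zint a b -> k \notin Zint c d -> g k = 0) ->
  \sum_(k <- Zint a b) g k = \sum_(k <- Zint c d) g k.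
Proof.
move=> ac db g0; rewrite (bigID (mem (Zint c d)))/= [X in _ + X]big_seq_cond.
rewrite [X in _ + X]big1 ?addr0 => [|k /andP[]]; last exact: g0.
rewrite -big_filter; apply/perm_big/uniq_perm; rewrite ?filter_uniq ?uniq_Zint//.
by move=> k; rewrite mem_filter !mem_Zint; lia.
Qed.

(** From [(u - v)^2 <= 2 u^2 + 2 v^2], whose defect is [(u + v)^2]; each of the two resulting sums
    lies within the window of [m + 1] terms. *)
Lemma sum_fdiff_sqr x a m :
  \sum_(0 <= i < m) fdiff x (a + i%:Z) ^+ 2 <=
  4 * \sum_(0 <= i < m.+1) x (a + i%:Z) ^+ 2.
Proof.
have fdiff_sqr i : fdiff x (a + i%:Z) ^+ 2 <=
    2 * x (a + i.+1%:Z) ^+ 2 + 2 * x (a + i%:Z) ^+ 2.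
  rewrite /fdiff (_ : a + i%:Z + 1 = a + i.+1%:Z); last by lia.
  by have := sqr_ge0 (x (a + i.+1%:Z) + x (a + i%:Z)); lra.
apply: (le_trans (ler_sum _ (fun i _ => fdiff_sqr i))).
rewrite big_split/= -!mulr_sumr.
have : \sum_(0 <= i < m) x (a + i.+1%:Z) ^+ 2 <=
    \sum_(0 <= i < m.+1) x (a + i%:Z) ^+ 2.
  by rewrite [leRHS]big_nat_recl// lerDr sqr_ge0.
have : \sum_(0 <= i < m) x (a + i%:Z) ^+ 2 <=
    \sum_(0 <= i < m.+1) x (a + i%:Z) ^+ 2.
  by rewrite [leRHS]big_nat_recr//= lerDl sqr_ge0.
lra.
Qed.

(** Each difference costs a factor 4 and one further term on the right, so [n] of them read [m + n]
    terms. *)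
Lemma sum_fdiffn_sqr n x a m :
  \sum_(0 <= i < m) fdiffn n x (a + i%:Z) ^+ 2 <=
  4 ^+ n * \sum_(0 <= i < m + n) x (a + i%:Z) ^+ 2.
Proof.
elim: n m => [|n IHn] m; first by rewrite mul1r addn0.
apply: (le_trans (sum_fdiff_sqr (fdiffn n x) a m)).
by rewrite exprS -mulrA ler_wpM2l// -addSnnS; exact: IHn.
Qed.

Lemma fdiffnS n x k : fdiffn n.+1 x k = fdiffn n x (k + 1) - fdiffn n x k.
Proof. by []. Qed.

Lemma fdiffnSr n x : fdiffn n.+1 x = fdiffn n (fdiff x).
Proof. exact: iterSr. Qed.

Lemma fdiffn_lin n (c : R) x y :
  fdiffn n (fun k => x k + c * y k) = fun k => fdiffn n x k + c * fdiffn n y k.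
Proof.
elim: n => // n IHn; apply/funext => k; rewrite !fdiffnS IHn; ring.
Qed.

Lemma fdiffn_shift n x (c : int) :
  fdiffn n (fun k => x (k + c)) = fun k => fdiffn n x (k + c).
Proof.
by elim: n => // n IHn; apply/funext => k; rewrite !fdiffnS IHn addrAC.
Qed.

Definition dirac_seq k : int -> R := fun i => (i == k)%:R.

Lemma fdiff_dirac_seq k :
  fdiff (dirac_seq k) = fun i => dirac_seq (k - 1) i + (-1) * dirac_seq k i.
Proof.
by apply/funext => i; rewrite /fdiff /dirac_seq mulN1r eq_sym -subr_eq eq_sym.
Qed.

(** The adjoint of the [n]-th difference is, up to the sign [(-1)^n], the same difference shifted
    back by [n]. The [n]-th difference of [dirac_seq k] vanishes outside [[k - n, k]], so there is
    no boundary term once [s] contains that window. Since the difference of [dirac_seq k] is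
    [dirac_seq (k - 1) - dirac_seq k], the inductive step subtracts the cases [k - 1] and [k]. *)
Lemma summation_by_parts n y (s : seq int) k : uniq s ->
  (forall i : int, k - n%:Z <= i <= k -> i \in s) ->
  \sum_(j <- s) y j * fdiffn n (dirac_seq k) j =
  (-1) ^+ n * fdiffn n (fun j => y (j - n%:Z)) k.
Proof.
move=> us; elim: n k => [|n IHn] k ks.
  rewrite (bigD1_seq k)/= ?ks ?subr0 ?lexx// /dirac_seq eqxx mulr1 mul1r.
  by rewrite big1 ?addr0// => j /negPf ->; rewrite mulr0.
rewrite (fdiffnSr _ (dirac_seq k)) fdiff_dirac_seq fdiffn_lin.
under eq_bigr do rewrite mulN1r mulrBr.
rewrite sumrB !IHn; last 2 first.
- by move=> i ik; apply: ks; lia.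
- by move=> i ik; apply: ks; lia.
rewrite fdiffnS (fdiffn_shift n y (- n%:Z)) (fdiffn_shift n y (- n.+1%:Z)).
rewrite -mulrBr exprS mulN1r mulNr -mulrN opprB.
by congr (_ * (fdiffn n _ _ - fdiffn n _ _)); lia.
Qed.

End FiniteDifferences.

(** * The primitive of [f k]: derivative and quadratic lower bound *)

Section Primitive.
Context {R : realType}.
Implicit Types (f : int -> R -> R) (k : int).

(** A product neighbourhood [U * V] of [(k, u)] contains the slice [{k} * V]. *)
Lemma jointly_continuous_section (N : nat) f k :
  jointly_continuous N f -> k \in Zint 1 N%:Z -> continuous (f k).
Proof.
move=> /subspace_continuousP fN kN u W.
move=> /(fN (k, u) kN)[[U V] [/= Uk Vu] UVW].
apply: filterS Vu => t Vt.
exact: (UVW (k, t) (conj (nbhs_singleton Uk) Vt) kN).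
Qed.

Lemma is_derive_primF f k (u : R) : continuous (f k) ->
  is_derive u 1 (primF f k) (f k u).
Proof.
(* A base point strictly below both 0 and [u]: near [u], both branches of [primF] then equal
   [G s - G 0], to which the fundamental theorem of calculus applies. *)
move=> cf; pose a := Num.min 0 u - 1.
have [a0 au] : a < 0 /\ a < u by rewrite /a; case: (leP 0 u) => ?; split; lra.
have integ (b c : R) :
    lebesgue_measure.-integrable `[b, c] (EFin \o f k).
  apply: continuous_compact_integrable; first exact: segment_compact.
  exact: continuous_subspaceT.
pose G s := \int[lebesgue_measure]_(t in `[a, s]) f k t.
have [dG G'u] : derivable G u 1 /\ derive1 G u = f k u.
  by apply: (@continuous_FTC1_closed _ (f k) a u (u + 1)) => //; [lra|exact: cf].
apply: (@near_eq_is_derive _ _ _ (fun s => G s - G 0)).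
  near=> s; have sa : a < s by near: s; exact: lt_nbhsr.
  rewrite /primF /G; case: ifPn => s0.
    rewrite Rintegral_itvB ?bnd_simp// ?ltW//.
    rewrite Rintegral_itv_obnd_cbnd//.
    by apply: integrableS (integ 0 s) => //; exact: subset_itv_oc_cc.
  move: s0; rewrite -ltNge => s0.
  rewrite -opprB Rintegral_itvB ?bnd_simp// ?ltW//.
  rewrite Rintegral_itv_obnd_cbnd//.
  by apply: integrableS (integ s 0) => //; exact: subset_itv_oc_cc.
rewrite -[f k u]subr0; apply: is_deriveB.
by apply: DeriveDef => //; rewrite -derive1E.
Unshelve. all: by end_near. Qed.

Lemma continuous_primF f k : continuous (f k) -> continuous (primF f k).
Proof.
move=> cf u; apply: differentiable_continuous; apply/derivable1_diffP.
by have [] := is_derive_primF u cf.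
Qed.

(** By compactness: [alpha * t ^+ 2 - primF f k t] is bounded above on [[-|M|, |M|]], so a constant
    absorbs the small arguments. The absolute value keeps the interval nonempty for every sign of
    [M]. *)
Lemma primF_lower_bound f k (M alpha : R) : continuous (f k) ->
  (forall u, M < `|u| -> alpha * u ^+ 2 <= primF f k u) ->
  exists C : R, forall u, alpha * u ^+ 2 - C <= primF f k u.
Proof.
move=> cf Fge.
have [c _ cmax] : exists2 c, c \in `[- `|M|, `|M|]%R & forall t,
    t \in `[- `|M|, `|M|]%R ->
    alpha * t ^+ 2 - primF f k t <= alpha * c ^+ 2 - primF f k c.
  apply: EVT_max; first by rewrite ge0_cp.
  apply: continuous_subspaceT => t; apply: cvgB; last exact: continuous_primF.
  by apply: cvgMl_tmp; apply: exprn_continuous.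
exists `|alpha * c ^+ 2 - primF f k c| => u.
have [uM|Mu] := leP `|u| `|M|.
  have := cmax u; rewrite in_itv/= -ler_norml uM => /(_ isT).
  by have := ler_norm (alpha * c ^+ 2 - primF f k c); lra.
have := Fge u (le_lt_trans (ler_norm M) Mu).
by have := normr_ge0 (alpha * c ^+ 2 - primF f k c); lra.
Qed.

End Primitive.

(** * Energy estimate and anti-coercivity of the functional *)

Section AntiCoercivity.
Context {R : realType}.
Implicit Types (n N : nat) (x p : int -> R) (f : int -> R -> R).

Lemma functionalJE n N p f x : functionalJ n N p f x =
  2^-1 * (\sum_(k <- Zint (1 - n%:Z) N%:Z) p k * fdiffn n x k ^+ 2) -
  \sum_(k <- Zint 1 N%:Z) primF f k (x k).
Proof.
rewrite /functionalJ sumrB mulr_sumr; congr (_ - _).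
  by apply: eq_bigr => k _; rewrite !mulrA.
rewrite (@sum_Zint_support _ (1 - n%:Z) N%:Z 1 N%:Z); [|lia|lia|]; last first.
  by move=> k; rewrite !mem_Zint => k1 k2; rewrite ifN//; lia.
rewrite big_seq [RHS]big_seq; apply: eq_bigr => k.
by rewrite mem_Zint => /andP[->].
Qed.

Lemma normE_sqr N x : normE N x ^+ 2 = \sum_(k <- Zint 1 N%:Z) x k ^+ 2.
Proof. by rewrite sqr_sqrtr// sumr_ge0// => k _; exact: sqr_ge0. Qed.

Lemma le_normE N x k : k \in Zint 1 N%:Z -> `|x k| <= normE N x.
Proof.
move=> kN; rewrite -sqrtr_sqr ler_wsqrtr// (bigD1_seq k) ?uniq_Zint//=.
by rewrite lerDl sumr_ge0// => j _; exact: sqr_ge0.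
Qed.

Lemma le_maxp n N p k : k \in Zint (1 - n%:Z) N%:Z -> p k <= maxp n N p.
Proof. by move=> kN; exact: le_bigmax_seq. Qed.

(** Differences at the [N + n] points of [Z[1-n, N]] read [x] on [Z[1-n, N+n]]; there an element of
    [E] vanishes off [Z[1, N]], so the enlarged sum of squares is still the squared norm. *)
Lemma energy_le n N p x : (0 < n)%N ->
  (forall k, k \in Zint (1 - n%:Z) N%:Z -> 0 <= p k) -> spaceE n N x ->
  \sum_(k <- Zint (1 - n%:Z) N%:Z) p k * fdiffn n x k ^+ 2 <=
  4 ^+ n * maxp n N p * normE N x ^+ 2.
Proof.
move=> n0 p0 xE; set P := maxp n N p.
have P0 : 0 <= P.
  have Z1n : (1 - n%:Z) \in Zint (1 - n%:Z) N%:Z by rewrite mem_Zint; lia.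
  exact: le_trans (p0 _ Z1n) (le_maxp p Z1n).
have EN : N%:Z = 1 - n%:Z + (N + n)%N%:Z - 1 by lia.
apply: (@le_trans _ _ (P * \sum_(k <- Zint (1 - n%:Z) N%:Z) fdiffn n x k ^+ 2)).
  rewrite mulr_sumr big_seq [leRHS]big_seq; apply: ler_sum => k kN.
  by rewrite ler_wpM2r ?sqr_ge0// le_maxp.
rewrite -mulrA [leRHS]mulrCA ler_wpM2l// normE_sqr {1}EN sum_Zint.
apply: (le_trans (sum_fdiffn_sqr _ _ _ _)); rewrite ler_wpM2l ?exprn_ge0//.
rewrite -(@sum_Zint _ _ _ (fun k => x k ^+ 2)).
rewrite (@sum_Zint_support _ (1 - n%:Z) _ 1 N%:Z); [by []|lia|lia|].
move=> k; rewrite !mem_Zint => k1 k2; rewrite xE ?expr0n// !mem_Zint.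
have [k0|k0] := leP k 0; [left|right]; lia.
Qed.

(** Superquadratic growth dominates any multiple of [u^2] for large [|u|], so both alternatives
    reduce to the quadratic one. *)
Lemma coercive_quadratic n N p f :
  (exists M alpha : R,
     [/\ 0 <= M,
         2^-1 * 4 ^+ n * maxp n N p < alpha &
         forall (k : int) (u : R), k \in Zint 1 N%:Z -> M < `|u| ->
           alpha * u ^+ 2 <= primF f k u]) \/
  (exists M alpha q : R,
     [/\ 0 <= M, 0 < alpha, 2 < q &
         forall (k : int) (u : R), k \in Zint 1 N%:Z -> M < `|u| ->
           alpha * `|u| `^ q <= primF f k u]) ->
  exists M alpha : R,
    2^-1 * 4 ^+ n * maxp n N p < alpha /\
    forall (k : int) (u : R), k \in Zint 1 N%:Z -> M < `|u| ->
      alpha * u ^+ 2 <= primF f k u.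
Proof.
move=> [[M [alpha [_ Ha HF]]]|[M [alpha [q [M0 a0 q2 HF]]]]].
  by exists M, alpha.
set c := 2^-1 * _ * _; pose beta := `|c| + 1.
have b0 : 0 < beta by rewrite /beta ltr_wpDl.
(* The second threshold solves [alpha * t^(q - 2) = beta]; beyond it [alpha * |u|^q] exceeds
   [beta * u^2]. *)
exists (Num.max M ((beta / alpha) `^ (q - 2)^-1)), beta; split.
  by rewrite /beta (le_lt_trans (ler_norm c))// ltrDl.
move=> k u kN; rewrite gt_max => /andP[Mu bu].
apply: le_trans (HF k u kN Mu).
have u0 : 0 < `|u| by exact: le_lt_trans Mu.
have q20 : 0 < q - 2 by rewrite subr_gt0.
have : beta / alpha <= `|u| `^ (q - 2).
  have <- : ((beta / alpha) `^ (q - 2)^-1) `^ (q - 2) = beta / alpha.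
    by rewrite -powRrM mulVf ?lt0r_neq0// powRr1// divr_ge0// ltW.
  by apply: ge0_ler_powR; rewrite ?nnegrE ?powR_ge0 ?ltW.
rewrite ler_pdivrMr// => bu2.
rewrite -[q](subrK 2) powRD; last by rewrite (gt_eqF u0) implybT.
rewrite powR_mulrn// real_normK ?num_real// mulrA ler_wpM2r ?sqr_ge0//.
by rewrite mulrC.
Qed.

Lemma anti_coercive_functionalJ n N p f (M alpha : R) : (0 < n)%N ->
  (forall k, k \in Zint (1 - n%:Z) N%:Z -> 0 <= p k) ->
  (forall k, k \in Zint 1 N%:Z -> continuous (f k)) ->
  2^-1 * 4 ^+ n * maxp n N p < alpha ->
  (forall (k : int) (u : R), k \in Zint 1 N%:Z -> M < `|u| ->
     alpha * u ^+ 2 <= primF f k u) ->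
  anti_coercive n N (functionalJ n N p f).
Proof.
move=> n0 p0 cf alphaP Fge.
have /choice[C FC] : forall k, exists C : R, k \in Zint 1 N%:Z ->
    forall u, alpha * u ^+ 2 - C <= primF f k u.
  move=> k; have [kN|kN] := boolP (k \in Zint 1 N%:Z); last by exists 0.
  have [C ?] := primF_lower_bound (cf _ kN) (fun u => Fge k u kN).
  by exists C.
pose S := \sum_(k <- Zint 1 N%:Z) C k.
pose d := alpha - 2^-1 * 4 ^+ n * maxp n N p.
have d0 : 0 < d by rewrite subr_gt0.
have J_le x : spaceE n N x -> functionalJ n N p f x <= S - d * normE N x ^+ 2.
  move=> xE; rewrite functionalJE.
  have := energy_le n0 p0 xE.
  have : alpha * normE N x ^+ 2 - S <= \sum_(k <- Zint 1 N%:Z) primF f k (x k).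
    rewrite normE_sqr mulr_sumr -sumrB big_seq [leRHS]big_seq.
    by apply: ler_sum => k kN; exact: FC.
  rewrite /d; lra.
(* The summand 1 forces the norm above 1, hence below its square, so no square root is needed in the
   radius. *)
move=> A; exists (1 + `|S - A| / d) => x xE Bx.
apply: le_lt_trans (J_le x xE) _.
have B0 : 0 <= `|S - A| / d by rewrite divr_ge0// ltW.
have : `|S - A| / d < normE N x ^+ 2.
  have N1 : 1 <= normE N x by lra.
  by have := ler_peMl (le_trans ler01 N1) N1; rewrite -expr2; lra.
rewrite ltr_pdivrMr//; have := ler_norm (S - A); lra.
Qed.

End AntiCoercivity.

(** * Existence of a maximizer and its Euler equation *)

Section Maximizer.
Context {R : realType}.
Implicit Types (n N : nat) (x y p : int -> R) (f : int -> R -> R).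

(** [spaceE] leaves the values outside [Z[1-n, N+n]] free; fixing them to 0 makes [x] depend on
    finitely many coordinates. *)
Definition supported N x := forall k, k \notin Zint 1 N%:Z -> x k = 0.

Lemma supported_spaceE n N x : supported N x -> spaceE n N x.
Proof.
by move=> xN i; rewrite !mem_Zint => iN; apply: xN; rewrite mem_Zint; lia.
Qed.

(* Coordinate 0 of the vector is ignored, so that [k] itself indexes [v]. *)
Definition ext_row N (v : 'rV[R]_N.+1) (k : int) : R :=
  if k \in Zint 1 N%:Z then v ord0 (inord `|k|) else 0.

Lemma supported_ext_row N (v : 'rV[R]_N.+1) : supported N (ext_row v).
Proof. by move=> k /negPf kN; rewrite /ext_row kN. Qed.

Lemma ext_rowK N x : supported N x ->
  ext_row (\row_(i < N.+1) x (i : nat)%:Z) = x.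
Proof.
move=> xN; apply/funext => k; rewrite /ext_row; case: ifPn => [|/xN//].
by rewrite mem_Zint => kN; rewrite mxE inordK; [congr x|]; lia.
Qed.

Lemma continuous_ext_row N k : continuous (fun v : 'rV[R]_N.+1 => ext_row v k).
Proof.
rewrite /ext_row; case: (k \in _); first exact: coord_continuous.
exact: cst_continuous.
Qed.

Lemma continuous_fdiffn_ext_row n N k :
  continuous (fun v : 'rV[R]_N.+1 => fdiffn n (ext_row v) k).
Proof.
elim: n k => [|n IHn] k; first exact: continuous_ext_row.
by move=> v; exact: (cvgB (IHn (k + 1) v) (IHn k v)).
Qed.

Lemma continuous_functionalJ_ext_row n N p f :
  (forall k, k \in Zint 1 N%:Z -> continuous (f k)) ->
  continuous (fun v : 'rV[R]_N.+1 => functionalJ n N p f (ext_row v)).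
Proof.
move=> cf; under eq_fun do rewrite functionalJE.
have cQ : continuous (fun v : 'rV[R]_N.+1 => 2^-1 *
    (\sum_(k <- Zint (1 - n%:Z) N%:Z) p k * fdiffn n (ext_row v) k ^+ 2)).
  suff cS : continuous (fun v : 'rV[R]_N.+1 =>
      \sum_(k <- Zint (1 - n%:Z) N%:Z) p k * fdiffn n (ext_row v) k ^+ 2).
    by move=> v; exact: cvgMl_tmp (cS v).
  apply: continuous_big => [|k _ v]; first exact: add_continuous.
  have c := @continuous_fdiffn_ext_row n N k v; exact: cvgMl_tmp (cvgM c c).
have cF : continuous (fun v : 'rV[R]_N.+1 =>
    \sum_(k <- Zint 1 N%:Z) primF f k (ext_row v k)).
  under eq_fun do rewrite big_seq.
  apply: continuous_big => [|k kN]; first exact: add_continuous.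
  move=> v; have := continuous_primF (cf k kN) (x := ext_row v k).
  exact: (continuous_comp (@continuous_ext_row N k v)).
by move=> v; exact: cvgB (cQ v) (cF v).
Qed.

(** Beyond norm [B] the functional stays below its value at 0. The cube [K] is compact, contains 0
    and every supported sequence of norm at most [B], so a maximum over [K] is global. *)
Lemma anti_coercive_max n N p f :
  (forall k, k \in Zint 1 N%:Z -> continuous (f k)) ->
  anti_coercive n N (functionalJ n N p f) ->
  exists2 x, supported N x & forall y, supported N y ->
    functionalJ n N p f y <= functionalJ n N p f x.
Proof.
move=> cf /(_ (functionalJ n N p f (ext_row (0 : 'rV_N.+1))))[B JB].
pose K := [set v : 'rV[R]_N.+1 | forall i, `[- `|B|, `|B|]%classic (v ord0 i)].
have K0 : K 0 by move=> i /=; rewrite mxE in_itv/= oppr_le0 !normr_ge0.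
have [|||v vK vmax] := @EVT_max_rV _ _
    (fun v : 'rV[R]_N.+1 => functionalJ n N p f (ext_row v)) K.
- by exists 0.
- apply: (@rV_compact _ _ (fun=> `[- `|B|, `|B|]%classic)) => _.
  exact: segment_compact.
- by apply: continuous_subspaceT; exact: continuous_functionalJ_ext_row.
exists (ext_row v); first exact: supported_ext_row.
move=> y yN; have [yB|By] := leP (normE N y) B; last first.
  apply: le_trans (ltW (JB y (supported_spaceE yN) By)) _.
  by apply: vmax; rewrite inE.
rewrite -(ext_rowK yN); apply: vmax; rewrite inE => i /=.
rewrite mxE in_itv/= -ler_norml.
(* The index outside [Z[1, N]] is the dummy coordinate 0, where [y] vanishes. *)
have [iN|/yN ->] := boolP (i%:Z \in Zint 1 N%:Z); last by rewrite normr0.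
exact: le_trans (le_normE y iN) (le_trans yB (ler_norm B)).
Qed.

(** Fermat's rule along the line [x + t * dirac_seq k], that is, vanishing of the [k]-th partial
    derivative. *)
Lemma max_functionalJ_critical n N p f x k :
  (forall k, k \in Zint 1 N%:Z -> continuous (f k)) -> supported N x ->
  (forall y, supported N y -> functionalJ n N p f y <= functionalJ n N p f x) ->
  k \in Zint 1 N%:Z ->
  \sum_(j <- Zint (1 - n%:Z) N%:Z)
    p j * fdiffn n x j * fdiffn n (dirac_seq k) j = f k (x k).
Proof.
move=> cf xN xmax kN.
pose y (t : R) := fun j => x j + t * dirac_seq k j.
have yN t : supported N (y t).
  move=> j jN; rewrite /y xN// /dirac_seq; case: eqVneq jN => [->|_ _].
    by rewrite kN.
  by rewrite mulr0 addr0.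
pose a := fdiffn n x; pose b := fdiffn n (@dirac_seq R k).
pose Z := Zint (1 - n%:Z) N%:Z.
pose A := 2^-1 * \sum_(j <- Z) p j * a j ^+ 2.
pose B := \sum_(j <- Z) p j * a j * b j.
pose C := 2^-1 * \sum_(j <- Z) p j * b j ^+ 2.
pose D := \sum_(j <- Zint 1 N%:Z | j != k) primF f j (x j).
(* Along the line the energy is a quadratic polynomial in [t], and only the [k]-th primitive
   varies. *)
have JyE t : functionalJ n N p f (y t) =
    (A + t * B + t ^+ 2 * C) - (primF f k (x k + t) + D).
  rewrite functionalJE [X in _ - X](bigD1_seq k) ?uniq_Zint//=.
  congr (_ - (_ + _)).
  - rewrite /A /B /C !mulr_sumr -!big_split/=; apply: eq_bigr => j _.
    by rewrite fdiffn_lin -/a -/b; field.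
  - by rewrite /y /dirac_seq eqxx mulr1.
  - by apply: eq_bigr => j /negPf jk; rewrite /y /dirac_seq jk mulr0 addr0.
have dJ (t : R) : is_derive t (1 : R) (fun t => functionalJ n N p f (y t))
    (B + 2 * t * C - f k (x k + t)).
  have dF : is_derive t (1 : R) (fun t => primF f k (x k + t)) (f k (x k + t)).
    rewrite -[f _ _]mulr1.
    apply: (@is_derive1_comp _ (primF f k) (fun t => x k + t)).
      exact/is_derive_primF/cf.
    have dx : is_derive t (1 : R) (cst (x k) + id) (0 + 1) by exact: is_deriveD.
    by rewrite -[X in is_derive _ _ _ X]add0r.
  have -> : (fun t => functionalJ n N p f (y t)) =
      (cst A + id * cst B + id ^+ 2 * cst C) -
      ((fun t => primF f k (x k + t)) + cst D).
    by apply/funext => s; rewrite JyE.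
  apply: is_derive_eq.
  by rewrite /GRing.scale/=; ring.
have : is_derive (0 : R) 1 (fun t => functionalJ n N p f (y t)) 0.
  apply: (@derive1_at_max _ _ (-1) 1) => [||| t _].
  - lra.
  - by move=> t _; have [] := dJ t.
  - by rewrite in_itv/=; lra.
  - have -> : y 0 = x by apply/funext => j; rewrite /y mul0r addr0.
    exact: xmax.
move=> [_]; have [_ ->] := dJ 0.
rewrite mulr0 mul0r !addr0 => /eqP; rewrite subr_eq0 => /eqP; exact.
Qed.

Lemma max_functionalJ_solution n N p f x :
  (forall k, k \in Zint 1 N%:Z -> continuous (f k)) -> supported N x ->
  (forall y, supported N y -> functionalJ n N p f y <= functionalJ n N p f x) ->
  is_solution n N p f x.
Proof.
move=> cf xN xmax; split=> [|k kN]; first exact: supported_spaceE.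
have := max_functionalJ_critical cf xN xmax kN.
rewrite (@summation_by_parts _ n (fun j => p j * fdiffn n x j)) ?uniq_Zint//.
  (* The sign [(-1)^n] from summation by parts meets the [(-1)^(n+1)] of the equation; their product
     is [-1]. *)
  by move=> <-; rewrite exprS mulN1r mulNr mulrA -expr2 sqrr_sign mul1r subrr.
(* For [1 <= k <= N] the window [[k - n, k]] lies in [Z[1-n, N]]. *)
by move: kN; rewrite mem_Zint => kN i ik; rewrite mem_Zint; lia.
Qed.

End Maximizer.

Theorem lemma8 (R : realType) (n N : nat) (hn : (1 <= n)%N) (hN : (2 <= N)%N)
  (p : int -> R)
  (hp : forall k : int, k \in Zint (1 - n%:Z) N%:Z -> 0 <= p k)
  (f : int -> R -> R) (hf : jointly_continuous N f)
  (hF :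
    (exists M alpha : R,
       [/\ 0 <= M,
           2^-1 * 4 ^+ n * maxp n N p < alpha &
           forall (k : int) (u : R), k \in Zint 1 N%:Z -> M < `|u| ->
             alpha * u ^+ 2 <= primF f k u])
    \/
    (exists M alpha q : R,
       [/\ 0 <= M, 0 < alpha, 2 < q &
           forall (k : int) (u : R), k \in Zint 1 N%:Z -> M < `|u| ->
             alpha * `|u| `^ q <= primF f k u])) :
  anti_coercive n N (functionalJ n N p f) /\
  exists x : int -> R, is_solution n N p f x.
Proof.
have cf k : k \in Zint 1 N%:Z -> continuous (f k).
  exact: jointly_continuous_section hf.
have [M [alpha [alphaP Fge]]] := coercive_quadratic hF.
have Janti := anti_coercive_functionalJ hn hp cf alphaP Fge.
split=> //; have [x xN xmax] := anti_coercive_max cf Janti.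
by exists x; exact: max_functionalJ_solution.
Qed.
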